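(* Let $r\in\mathbb{N}$ with $r\ge 2$, let $\beta=(\beta_n)$ be a nonnegative sequence satisfying $$\sum_{k=1}^{\infty}\frac{\beta_k}{k}<\infty,$$ and let $b=(b_n)\in RBVS(\beta,r)$. Then $\|S_n(g)-g\|=o(1)$ as $n\to\infty$.
   Context: $\mathbb{N}=\{1,2,\dots\}$. For a nonnegative sequence $\beta=(\beta_n)$ and $r\in\mathbb{N}$, a sequence of complex numbers $(b_n)$ belongs to $RBVS(\beta,r)$ (is a $(\beta,r)$-rest bounded variation sequence) if there is a constant $C$ such that $\sum_{n=m}^{\infty}|b_n-b_{n+r}|\le C\beta_m$ for all $m\in\mathbb{N}$. The norm is $\|F\|=\frac1{2\pi}\int_{-\pi}^{\pi}|F(x)|\,dx$. For the sine series $\sum_{k=1}^{\infty}b_k\sin kx$, $S_n(g,x)=\sum_{k=1}^{n}b_k\sin kx$ denotes its partial sums and $g(x)$ its sum at each point $x$ where the series converges; the conclusion includes that $g$ is defined almost everywhere.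
   Formalization: The formal theorem adds the hypothesis b_n → 0; without it the claim fails (β_n = 0, b_n = 1 for all n lies in RBVS(β,r), yet Σ sin kx diverges for x outside πZ), and b_n → 0 is necessary for ‖S_n(g)−g‖ → 0. *)

(* Defs.v *)
From HB Require Import structures.
From mathcomp Require Import all_boot all_order all_algebra.
From mathcomp Require Import complex.
From mathcomp Require Import all_classical all_reals all_analysis.

Set Implicit Arguments.
Unset Strict Implicit.
Unset Printing Implicit Defensive.

Import Order.TTheory GRing.Theory Num.Theory.
Import numFieldNormedType.Exports.

Local Open Scope classical_set_scope.
Local Open Scope ring_scope.
Local Open Scope complex_scope.

(* Sequences indexed by {1, 2, ...} are functions on nat whose value at 0 is
   never used. *)

(* The modulus of a complex number as an element of R: the norm `|z| of the
   library is an element of R[i]. *)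
Definition cmod (R : realType) (z : R[i]) : R := complex.Re `|z|.

Definition RBVS (R : realType) (beta : nat -> R) (r : nat) (b : nat -> R[i])
    : Prop :=
  exists C : R, forall m : nat, (1 <= m)%N ->
    (\sum_(m <= n <oo) (cmod (b n - b (n + r)%N))%:E <= (C * beta m)%:E)%E.

Definition sine_partial (R : realType) (b : nat -> R[i]) (n : nat) (x : R)
    : R[i] :=
  \sum_(1 <= k < n.+1) b k * (sin (k%:R * x))%:C.

(* The topology given by the modulus is canonical on R[i]^o but not on R[i],
   hence the cast; [lim] is the default value 0 where the series diverges. *)
Definition sine_sum (R : realType) (b : nat -> R[i]) (x : R) : R[i] :=
  lim ((fun n => sine_partial b n x : R[i]^o) @ \oo).

Definition L1norm (R : realType) (F : R -> R[i]) : \bar R :=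
  (((2 * pi)^-1)%:E *
   \int[@lebesgue_measure R]_(x in `[(- pi)%R, pi%R]) (cmod (F x))%:E)%E.

(* Main.v *)
Require Import Defs.
From HB Require Import structures.
From mathcomp Require Import all_boot all_order all_algebra.
From mathcomp Require Import complex.
From mathcomp Require Import all_classical all_reals all_analysis.
From mathcomp Require Import measurable_realfun.
From mathcomp Require Import ring lra zify.

Set Implicit Arguments.
Unset Strict Implicit.
Unset Printing Implicit Defensive.

Import Order.TTheory GRing.Theory Num.Theory.
Import numFieldNormedType.Exports.

Local Open Scope classical_set_scope.
Local Open Scope ring_scope.
Local Open Scope complex_scope.

(** Write [V m] for the variation sum_{n >= m} |b_n - b_{n+r}|, which is
nonincreasing, tends to 0, is at most a constant times beta_m and, because
b tends to 0 along every residue class modulo r, dominates |b_m|.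

The convergence in mean is obtained by dominated convergence.  Since
2 sin(rx/2) sin(kx) = cos(kx - rx/2) - cos((k+r)x - rx/2), a summation by parts
with step r bounds 2 |sin(rx/2)| |S_N(x) - S_n(x)| by (2r+1) V(n+1)
([sine_tail_le]).  Hence the series converges wherever sin(rx/2) does not
vanish, that is, off a countable set.

Let s = |sin(rx/2)| > 0 and let m be the integer part of 1/s.  Below the index m
the terms are estimated by V(k), beyond m by V(m)/s, which is at most 2m V(m) and
so at most twice V(1) + ... + V(m).  Therefore, uniformly in n and N,

  |S_N(x) - S_n(x)| <= (2r+2) sum_{k >= 1} V(k) 1[k |sin(rx/2)| <= 1]

([sine_tail_dominated]).  On [-pi, pi] the set where k |sin(rx/2)| <= 1 is covered
by 2r+1 intervals of length 8/k around the zeros of sin(rx/2)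
([lebesgue_measure_near_zero]), so the integral of the right-hand side is at
most a constant times sum_k V(k)/k, hence times sum_k beta_k/k, which is finite
([sine_majorant_integrable]). *)

(** * The modulus of complex numbers and convergence *)

Section Modulus.
Variable R : realType.
Implicit Types z w : R[i].

Lemma cmod_normc z : cmod z = Normc.normc z.
Proof. by []. Qed.

Lemma normC_cmod z : `|z| = (cmod z)%:C.
Proof. by []. Qed.

Lemma cmod_ge0 z : 0 <= cmod z.
Proof. by rewrite -lecR -normC_cmod normr_ge0. Qed.

Lemma cmodD z w : cmod (z + w) <= cmod z + cmod w.
Proof. exact: le_normcD. Qed.

Lemma cmodM z w : cmod (z * w) = cmod z * cmod w.
Proof. exact: Normc.normcM. Qed.

Lemma cmodN z : cmod (- z) = cmod z.
Proof. exact: normcN. Qed.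

Lemma cmodB z w : cmod (z - w) <= cmod z + cmod w.
Proof. by rewrite -(cmodN w) cmodD. Qed.

Lemma cmodC z w : cmod (z - w) = cmod (w - z).
Proof. by rewrite -cmodN opprB. Qed.

Lemma cmod_real (t : R) : cmod t%:C = `|t|.
Proof. by rewrite cmod_normc /= expr0n /= addr0 sqrtr_sqr. Qed.

Lemma cmod0 : cmod (0 : R[i]) = 0.
Proof. exact: Normc.normc0. Qed.

Lemma cmod_sum (I : Type) (s : seq I) (P : pred I) (f : I -> R[i]) :
  cmod (\sum_(i <- s | P i) f i) <= \sum_(i <- s | P i) cmod (f i).
Proof.
elim/big_rec2 : _ => [|i y z _ yz]; first by rewrite cmod0.
by rewrite (le_trans (cmodD _ _))// lerD2l.
Qed.

Lemma Re_le_cmod z : `|complex.Re z| <= cmod z.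
Proof. by rewrite -lecR normc_ge_Re. Qed.

Lemma Im_le_cmod z : `|complex.Im z| <= cmod z.
Proof.
case: z => a c; rewrite cmod_normc /= -(sqrtr_sqr c) ler_wsqrtr//.
by rewrite lerDr sqr_ge0.
Qed.

Lemma cmod_le_ReIm z : cmod z <= `|complex.Re z| + `|complex.Im z|.
Proof.
rewrite {1}[z]complexE (le_trans (cmodD _ _))// cmodM !cmod_real.
by rewrite cmod_normc /= expr0n /= add0r expr1n sqrtr1 mul1r.
Qed.

(** Convergence in [R[i]^o] is stated with a radius and a norm that are elements
of [R[i]]; this brings it back to a real sequence. *)
Lemma cvg_cmodP (u : nat -> R[i]) (l : R[i]) :
  ((u : nat -> R[i]^o) @ \oo --> (l : R[i]^o)) <->
  cmod (u n - l) @[n --> \oo] --> 0.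
Proof.
split=> [/cvgrPdist_lt ul|/cvgrPdist_lt ul].
  apply/cvgrPdist_lt => e e0.
  have : 0 < e%:C by rewrite ltcR.
  move/ul; apply: filterS => n h.
  have {}h : cmod (l - u n) < e by rewrite -ltcR.
  by rewrite sub0r normrN ger0_norm ?cmod_ge0// cmodC.
apply/cvgrPdist_lt => -[e ei]; rewrite ltcE/= => /andP[/eqP -> e0].
move/ul : (e0); apply: filterS => n.
rewrite sub0r normrN ger0_norm ?cmod_ge0// => h.
by have : (cmod (l - u n))%:C < e%:C by rewrite ltcR cmodC.
Qed.

Lemma cvg_cmod_dist (u : nat -> R[i]) (l a : R[i]) :
  ((u : nat -> R[i]^o) @ \oo --> (l : R[i]^o)) ->
  cmod (a - u n) @[n --> \oo] --> cmod (a - l).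
Proof.
move=> /cvg_cmodP /cvgrPdist_lt ul; apply/cvgrPdist_lt => e /ul.
apply: filterS => n; rewrite sub0r normrN ger0_norm ?cmod_ge0//.
apply: le_lt_trans; rewrite ler_distl.
have := cmodD (a - u n) (u n - l); have := cmodD (a - l) (l - u n).
by rewrite !subrKA (cmodC l) => h1 h2; apply/andP; split; lra.
Qed.

(** The Cauchy criterion with an explicit modulus [e], the form in which the
estimates on tails of series come. *)
Lemma real_cauchy_modulus_cvg (u e : nat -> R) : e @ \oo --> 0 ->
  (forall n N, (n <= N)%N -> `|u N - u n| <= e n) -> cvg (u @ \oo).
Proof.
move=> /cvgrPdist_lt e0 ue; apply/cauchy_cvgP/cauchy_exP => eps eps0.
have [n _ ne] := e0 _ eps0; exists (u n).
exists n => // N /= nN; rewrite -ball_normE/= distrC (le_lt_trans (ue _ _ nN))//.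
by have := ne n (leqnn n); rewrite /= sub0r normrN; apply/le_lt_trans/ler_norm.
Qed.

(** Completeness of the complex field, from that of the real field applied to the
real and imaginary parts. *)
Lemma cauchy_modulus_cvg (u : nat -> R[i]) (e : nat -> R) : e @ \oo --> 0 ->
  (forall n N, (n <= N)%N -> cmod (u N - u n) <= e n) ->
  cvg ((u : nat -> R[i]^o) @ \oo).
Proof.
move=> e0 ue.
have cre : cvg ((fun n => complex.Re (u n)) @ \oo).
  apply: (real_cauchy_modulus_cvg e0) => n N nN; apply: le_trans (ue n N nN).
  by apply: le_trans (Re_le_cmod _); case: (u N) (u n) => [? ?] [? ?].
have cim : cvg ((fun n => complex.Im (u n)) @ \oo).
  apply: (real_cauchy_modulus_cvg e0) => n N nN; apply: le_trans (ue n N nN).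
  by apply: le_trans (Im_le_cmod _); case: (u N) (u n) => [? ?] [? ?].
set x := lim _ in cre; set y := lim _ in cim.
apply/cvg_ex; exists (x +i* y); apply/cvg_cmodP.
have h : (`|complex.Re (u n) - x| + `|complex.Im (u n) - y|) @[n --> \oo] --> 0.
  rewrite -(addr0 0); apply: cvgD.
    rewrite -[X in _ --> X](normr0 R) -(subrr x); apply: cvg_norm.
    by apply: cvgB => //; exact: cvg_cst.
  rewrite -[X in _ --> X](normr0 R) -(subrr y); apply: cvg_norm.
  by apply: cvgB => //; exact: cvg_cst.
apply: squeeze_cvgr h; last exact: cvg_cst.
apply: nearW => n; rewrite cmod_ge0 (le_trans (cmod_le_ReIm _))//.
by case: (u n).
Qed.

End Modulus.

(** * Neighbourhoods of the zeros of sin(rx/2) *)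

Section SineZeros.
Variable R : realType.
Implicit Types x y : R.

(** A weak form of the inequality of Jordan, enough to compare |sin| with the
distance to its zeros.  With t = y/2 it follows from sin y = 2 cos t sin t,
from t cos t <= sin t (mean value theorem) and from 2 cos^2 t - 1 = cos y >= 0. *)
Lemma half_le_sin y : 0 <= y <= pi / 2 -> y / 2 <= sin y.
Proof.
move=> /andP[y0 ypi]; set t := y / 2.
have pi0 : 0 < pi :> R by exact: pi_gt0.
have yE : y = t *+ 2 by rewrite /t -mulr_natr; lra.
have t0 : 0 <= t by rewrite /t; lra.
have tpi : t <= pi / 4 by rewrite /t; lra.
have cy : 0 <= cos y by apply: cos_ge0_pihalf; apply/andP; split; lra.
have ct : 0 <= cos t by apply: cos_ge0_pihalf; apply/andP; split; lra.
have tcos : t * cos t <= sin t.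
  have [c] := @MVT_segment R sin cos 0 t t0
    (fun x _ => is_derive_sin x) (continuous_subspaceT (@continuous_sin R)).
  rewrite in_itv/= => /andP[c0 ct']; rewrite sin0 !subr0 => ->.
  rewrite mulrC ler_wpM2r//.
  move: ct'; rewrite le_eqVlt => /predU1P[->//|lect].
  by apply/ltW; rewrite ltr_cos// in_itv/=; apply/andP; split; lra.
have : cos t * (t * cos t) <= cos t * sin t by rewrite ler_wpM2l.
have : 0 <= t * cos y by rewrite mulr_ge0.
rewrite [X in _ <= sin X]yE sin_mulr2n [X in cos X]yE cos_mulr2n !mulr2n -/t.
by rewrite expr2; lra.
Qed.

Lemma half_norm_le_norm_sin y : `|y| <= pi / 2 -> `|y| / 2 <= `|sin y|.
Proof.
move=> hy; have -> : `|sin y| = `|sin `|y| |.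
  by case: (ger0P y) => //; rewrite sinN normrN.
by rewrite (le_trans _ (ler_norm _))// half_le_sin// hy normr_ge0.
Qed.

Definition sin_half (r : nat) x : R := `|sin (r%:R * x / 2)|.

(** The zero 2 pi j / r of sin(rx/2), the index being shifted by r so that the
natural numbers [l] <= 2r give all the zeros of [[-pi, pi]]. *)
Definition sin_half_zero (r l : nat) : R := 2 * pi * (l%:R - r%:R) / r%:R.

(** Translating y = rx/2 by r pi makes it nonnegative, so that the nearest
multiple of pi is found by truncation; modulo pi, |sin y| only depends on the
signed distance to that multiple, which is at most pi/2. *)
Lemma dist_sin_half_zero r x : (0 < r)%N -> - pi <= x <= pi ->
  exists2 l, (l < r.*2.+1)%N & `|x - sin_half_zero r l| <= 4 * sin_half r x.
Proof.
move=> r0 /andP[xl xr]; have pi0 : 0 < pi :> R by exact: pi_gt0.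
have r1 : 1 <= r%:R :> R by rewrite ler1n.
pose y := r%:R * x / 2; pose z := y + r%:R * pi.
have yb : - (r%:R * pi) <= 2 * y <= r%:R * (pi : R).
  rewrite /y; apply/andP; split; nra.
have rpi : 0 < r%:R * pi :> R by rewrite mulr_gt0// (lt_le_trans ltr01).
have z0 : 0 <= z / pi + 1 / 2.
  by rewrite addr_ge0// divr_ge0 ?(ltW pi0)// /z; move: yb => /andP[? ?]; lra.
pose l := Num.truncn (z / pi + 1 / 2).
have /andP[ll lu] := Num.Theory.truncn_itv z0; rewrite -/l in ll lu.
have lz : l%:R * pi <= z + pi / 2.
  have : l%:R * pi <= (z / pi + 1 / 2) * pi by rewrite ler_wpM2r// ltW.
  by rewrite mulrDl mulfVK ?gt_eqF//; lra.
have zl : z + pi / 2 < l%:R * pi + pi.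
  have : (z / pi + 1 / 2) * pi < l.+1%:R * pi by rewrite ltr_pM2r.
  by rewrite mulrDl mulfVK ?gt_eqF// -natr1; lra.
exists l.
  rewrite ltnS -(ler_nat R) -muln2 natrM -(ler_pM2r pi0).
  apply: (le_trans lz); rewrite /z.
  by move: yb => /andP[? ?]; nra.
have sinE : `|sin (z - l%:R * pi)| = sin_half r x.
  have sinp n v : `|sin (v + n%:R * pi)| = `|sin v| :> R.
    rewrite mulr_natl (alternatingn (@sinDpi R)) normrM normrX normrN1.
    by rewrite expr1n mul1r.
  by rewrite -(sinp l) subrK /z sinp.
have distE : z - l%:R * pi = r%:R / 2 * (x - sin_half_zero r l).
  rewrite /z /y /sin_half_zero; field; rewrite gt_eqF//.
  exact: lt_le_trans r1.
have : `|z - l%:R * pi| <= pi / 2 by rewrite ler_norml; apply/andP; split; lra.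
move/half_norm_le_norm_sin; rewrite sinE distE normrM ger0_norm; last lra.
have := normr_ge0 (x - sin_half_zero r l).
by nra.
Qed.

Definition near_zero (r k : nat) : set R := [set x | k%:R * sin_half r x <= 1].

Lemma continuous_sin_half r : continuous (sin_half r).
Proof.
move=> x; apply: continuous_comp; last exact: norm_continuous.
apply: continuous_comp; last exact: continuous_sin.
apply: cvgM; last exact: cvg_cst.
by apply: cvgM; [exact: cvg_cst|exact: cvg_id].
Qed.

Lemma measurable_near_zero r k : measurable (near_zero r k).
Proof.
have -> : near_zero r k = (fun x => k%:R * sin_half r x) @^-1` `]-oo, 1]%classic.
  by apply/seteqP; split => x; rewrite /near_zero /= in_itv.
have mf : measurable_fun setT (fun x => k%:R * sin_half r x).
  apply: continuous_measurable_fun => x.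
  by apply: cvgM; [exact: cvg_cst|exact: continuous_sin_half].
by rewrite -[X in measurable X]setTI; apply: mf => //; exact: measurable_itv.
Qed.

(** By [dist_sin_half_zero], the set is covered by the 2r+1 intervals of radius
4/k centred at the zeros. *)
Lemma lebesgue_measure_near_zero r k : (0 < r)%N -> (0 < k)%N ->
  (lebesgue_measure (near_zero r k `&` `[(- pi)%R, pi%R]%classic)
   <= (8 * r.*2.+1%:R / k%:R)%:E)%E.
Proof.
move=> r0 k0; have k0' : 0 < k%:R :> R by rewrite ltr0n.
pose B l : set R := closed_ball (sin_half_zero r l) (4 / k%:R).
have mB l : measurable (B l) by exact: measurable_closed_ball.
apply: (@le_trans _ _ (\sum_(l < r.*2.+1) lebesgue_measure (B l))%E).
  apply: (@content_subadditive _ _ _ (@lebesgue_measure R)).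
  - by move=> l _; exact: mB.
  - by apply: measurableI; [exact: measurable_near_zero|exact: measurable_itv].
  rewrite -bigcup_mkord => x [xk]; rewrite /= in_itv/= => xpi.
  have [l lr xl] := dist_sin_half_zero r0 xpi.
  exists l => //; rewrite /B closed_ballE ?divr_gt0//.
  rewrite /closed_ball_/= distrC (le_trans xl)// ler_pdivlMr//.
  by move: xk; rewrite /near_zero/=; lra.
rewrite (eq_bigr (fun=> (8 / k%:R)%:E)); last first.
  move=> l _; rewrite /B lebesgue_measure_closed_ball ?divr_ge0//; congr _%:E.
  by rewrite -(mulr_natl _ 2); field; rewrite gt_eqF.
by rewrite sumEFin lee_fin sumr_const card_ord -[X in X <= _]mulr_natl mulrA (mulrC 8).
Qed.

(** For [M] large x/M lies in [[-pi, pi]], and sin(rx/2) = sin((rM)(x/M)/2), so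
[dist_sin_half_zero] at x/M and order rM locates x. *)
Lemma sin_half_zeros_countable r : (0 < r)%N ->
  countable [set x | sin_half r x = 0].
Proof.
move=> r0; have pi0 : 0 < pi :> R by exact: pi_gt0.
pose f (p : nat * nat) : R := p.1%:R * sin_half_zero (r * p.1) p.2.
apply: (@sub_countable _ _ _ (range f)); last exact/(card_le_trans (card_image_le _ _))/countableP.
apply: subset_card_le => x /= x0.
pose M := (Num.truncn (`|x| / pi)).+1.
have M0 : 0 < M%:R :> R by rewrite ltr0n.
have xM : `|x| <= M%:R * pi.
  rewrite -ler_pdivrMr//.
  by have /andP[_ /ltW] := Num.Theory.truncn_itv (divr_ge0 (normr_ge0 x) (ltW pi0)).
have rM0 : (0 < r * M)%N by rewrite muln_gt0 r0.
have xMpi : - pi <= x / M%:R <= pi.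
  move: xM; rewrite ler_norml => /andP[xl xr].
  by rewrite ler_pdivlMr// ler_pdivrMr//; apply/andP; split; lra.
have [l _] := dist_sin_half_zero rM0 xMpi.
have -> : sin_half (r * M) (x / M%:R) = sin_half r x.
  by rewrite /sin_half natrM; congr (`|sin (_ / 2)|); field; rewrite gt_eqF.
rewrite x0 mulr0 normr_le0 subr_eq0 => /eqP xE.
by exists (M, l) => //; rewrite /f/= -xE mulrC divfK// gt_eqF.
Qed.

End SineZeros.

(** * The variation of the tails of the coefficients *)

Section RestVariation.
Variables (R : realType) (r : nat) (b : nat -> R[i]).
Hypothesis r_gt0 : (0 < r)%N.

Let d n : R := cmod (b n - b (n + r)%N).

Definition rest_variation (m : nat) : R :=
  fine (\sum_(m <= n <oo) (cmod (b n - b (n + r)%N))%:E)%E.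

Local Notation V := rest_variation.

Variable beta : nat -> R.
Hypothesis hb : RBVS beta r b.

Let d0 n : (0 <= (d n)%:E)%E.
Proof. by rewrite lee_fin cmod_ge0. Qed.

Lemma rest_variationE m : (0 < m)%N ->
  (V m)%:E = (\sum_(m <= n <oo) (d n)%:E)%E.
Proof.
move=> m0; rewrite /V fineK// ge0_fin_numE; last first.
  by apply: nneseries_ge0 => n _ _; exact: d0.
by have [C /(_ m m0)/le_lt_trans->//] := hb; rewrite ltry.
Qed.

Lemma rest_variation_ge0 m : (0 < m)%N -> 0 <= V m.
Proof.
move=> m0; rewrite -lee_fin rest_variationE//.
by apply: nneseries_ge0 => n _ _; exact: d0.
Qed.

Lemma sum_le_rest_variation m n : (0 < m)%N ->
  \sum_(m <= k < n) cmod (b k - b (k + r)%N) <= V m.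
Proof.
move=> m0; rewrite -lee_fin rest_variationE// -sumEFin.
by apply: nneseries_lim_ge => k _ _; exact: d0.
Qed.

Lemma rest_variation_nincr m n : (0 < m)%N -> (m <= n)%N -> V n <= V m.
Proof.
move=> m0 mn; rewrite -lee_fin !rest_variationE//; last exact: leq_trans m0 mn.
rewrite (nneseries_split m (n - m))// subnKC// leeDr//.
by rewrite sume_ge0.
Qed.

Lemma rest_variation_cvg0 : V @ \oo --> 0.
Proof.
have V1 : (\sum_(0 <= n <oo) (d n)%:E < +oo)%E.
  rewrite (nneseries_split 0 1)// add0n -rest_variationE//.
  by rewrite big_nat1 -EFinD ltry.
have /fine_cvg := nneseries_tail_cvg V1 (fun k _ => d0 k).
exact.
Qed.

Lemma rest_variation_le_bound : (forall n, (0 < n)%N -> 0 <= beta n) ->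
  exists2 C, 0 <= C & forall m, (0 < m)%N -> V m <= C * beta m.
Proof.
move=> beta0; have [C hC] := hb; exists `|C| => // m m0.
rewrite -lee_fin rest_variationE// (le_trans (hC m m0))// lee_fin.
by rewrite ler_wpM2r ?beta0 ?ler_norm.
Qed.

Hypothesis b0 : (b : nat -> R[i]^o) @ \oo --> (0 : R[i]^o).

(** Telescoping with step r from m up to m + jr, where b is small for large j. *)
Lemma cmod_le_rest_variation m : (0 < m)%N -> cmod (b m) <= V m.
Proof.
move=> m0.
have step j : cmod (b m) <=
    cmod (b (m + j * r)%N) + \sum_(m <= k < m + j * r) d k.
  elim: j => [|j IH]; first by rewrite mul0n addn0 big_geq// addr0.
  apply: (le_trans IH).
  have mj : (m <= m + j * r)%N by rewrite leq_addr.
  have jS : (m + j * r < m + j.+1 * r)%N by rewrite ltn_add2l ltn_pmul2r.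
  rewrite (big_cat_nat (n := (m + j * r)%N) mj (ltnW jS))/= (big_ltn jS).
  have := cmodD (b (m + j.+1 * r)%N) (b (m + j * r)%N - b (m + j.+1 * r)%N).
  have -> : b (m + j.+1 * r)%N = b (m + j * r + r)%N by congr b; rewrite mulSn; lia.
  rewrite subrKC -/(d _).
  have : 0 <= \sum_((m + j * r).+1 <= i < m + j.+1 * r) d i.
    by apply: sumr_ge0 => i _; exact: cmod_ge0.
  lra.
apply/ler_addgt0Pr => e e0.
have /cvg_cmodP/cvgrPdist_lt/(_ e e0)[N _ hN] := b0.
have := hN (m + N * r)%N; rewrite /= sub0r normrN subr0 ger0_norm ?cmod_ge0//.
have -> : (N <= m + N * r)%N by rewrite (leq_trans _ (leq_addl _ _))// leq_pmulr.
move=> /(_ isT) bN.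
have := sum_le_rest_variation (m + N * r) m0; have := step N.
rewrite -/(d _); move: (cmod (b (m + N * r)%N)) bN => v ? h1 h2.
apply: (le_trans h1); rewrite addrC lerD//; exact: ltW.
Qed.

End RestVariation.

(** * Estimates of the tails of the sine series *)

(** Telescoping with step [r]: only [r] terms at each end survive. *)
Lemma sum_sub_shift (A : zmodType) (f : nat -> A) (r n N : nat) : (n <= N)%N ->
  \sum_(n <= k < N) (f k - f (k + r)%N) =
  \sum_(j < r) (f (n + j)%N - f (N + j)%N).
Proof.
move=> /subnKC <-; elim: (N - n)%N => [|p IH].
  by rewrite addn0 big_geq// big1// => j _; rewrite subrr.
have shift M : f M - f (M + r)%N = \sum_(j < r) (f (M + j)%N - f (M.+1 + j)%N).
  rewrite -(big_mkord xpredT (fun j => f (M + j)%N - f (M.+1 + j)%N)).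
  rewrite (eq_bigr (fun j => - (f (M + j.+1)%N - f (M + j)%N))).
    by rewrite sumrN (telescope_sumr (fun j => f (M + j)%N))// opprB addn0.
  by move=> j _; rewrite opprB addSnnS.
rewrite addnS big_nat_recr ?leq_addr//= IH shift -big_split/=.
by apply: eq_bigr => j _; rewrite subrKA.
Qed.

Section SineTails.
Variables (R : realType) (r : nat) (b : nat -> R[i]) (beta : nat -> R).
Hypothesis r_gt0 : (0 < r)%N.
Hypothesis hb : RBVS beta r b.
Hypothesis b0 : (b : nat -> R[i]^o) @ \oo --> (0 : R[i]^o).

Local Notation V := (rest_variation r b).

Lemma sine_partialB n N x : (n <= N)%N ->
  sine_partial b N x - sine_partial b n x =
  \sum_(n.+1 <= k < N.+1) b k * (sin (k%:R * x))%:C.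
Proof.
move=> nN; rewrite /sine_partial (big_cat_nat (n := n.+1))//=.
by rewrite addrAC subrr add0r.
Qed.

(** With T(k) = cos(kx - rx/2) one has 2 sin(rx/2) sin(kx) = T(k) - T(k+r), and
b_k (T(k) - T(k+r)) = (b_k T(k) - b_{k+r} T(k+r)) - (b_k - b_{k+r}) T(k+r), where
the first difference telescopes with step r. *)
Lemma sine_tail_by_parts n N x : (n <= N)%N ->
  let T k := (cos (k%:R * x - r%:R * x / 2))%:C in
  (2 * sin (r%:R * x / 2))%:C * (sine_partial b N x - sine_partial b n x) =
  \sum_(j < r) (b (n.+1 + j)%N * T (n.+1 + j)%N - b (N.+1 + j)%N * T (N.+1 + j)%N)
  - \sum_(n.+1 <= k < N.+1) (b k - b (k + r)%N) * T (k + r)%N.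
Proof.
move=> nN T; rewrite sine_partialB// mulr_sumr.
have n1N1 : (n.+1 <= N.+1)%N by [].
rewrite -(sum_sub_shift (fun k => b k * T k) r n1N1) -sumrB.
apply: eq_bigr => k _.
have TB : T k - T (k + r)%N = (2 * sin (r%:R * x / 2))%:C * (sin (k%:R * x))%:C.
  rewrite /T -rmorphB -rmorphM; congr (_%:C).
  have -> : (k + r)%:R * x - r%:R * x / 2 = k%:R * x + r%:R * x / 2.
    by rewrite natrD; lra.
  by rewrite cosB cosD; ring.
rewrite (_ : _ - _ = b k * (T k - T (k + r)%N)); first by rewrite TB; ring.
by ring.
Qed.

Lemma cmod_scale_cos (z : R[i]) (t : R) : cmod (z * (cos t)%:C) <= cmod z.
Proof. by rewrite cmodM cmod_real ler_piMr ?cmod_ge0 ?cos_max. Qed.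

(** The 2r boundary terms are each at most V(n+1), and so is the remaining sum of
differences. *)
Lemma sine_tail_le n N x : (n <= N)%N ->
  2 * sin_half r x * cmod (sine_partial b N x - sine_partial b n x)
  <= r.*2.+1%:R * V n.+1.
Proof.
move=> nN.
have -> : 2 * sin_half r x * cmod (sine_partial b N x - sine_partial b n x) =
    cmod ((2 * sin (r%:R * x / 2))%:C
          * (sine_partial b N x - sine_partial b n x)).
  by rewrite cmodM cmod_real normrM ger0_norm.
rewrite sine_tail_by_parts// (le_trans (cmodB _ _))//.
rewrite -[r.*2.+1%:R]natr1 mulrDl mul1r lerD//.
  rewrite (le_trans (cmod_sum _ _ _))//.
  apply: (@le_trans _ _ (\sum_(j < r) (2 * V n.+1))); last first.
    by rewrite sumr_const card_ord -muln2 natrM -mulrA [X in _ <= X]mulr_natl.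
  apply: ler_sum => j _; rewrite (le_trans (cmodB _ _))// mulr2n mulrDl mul1r.
  have bV m : (n.+1 <= m)%N -> cmod (b m) <= V n.+1.
    move=> nm; have m0 : (0 < m)%N by exact: leq_trans nm.
    rewrite (le_trans (cmod_le_rest_variation r_gt0 hb b0 m0))//.
    exact: rest_variation_nincr hb _ _ _ _.
  rewrite lerD// (le_trans (cmod_scale_cos _ _))// bV//; lia.
rewrite (le_trans _ (sum_le_rest_variation hb N.+1 (ltn0Sn n)))//.
rewrite (le_trans (cmod_sum _ _ _))//.
by apply: ler_sum => k _; exact: cmod_scale_cos.
Qed.

(** Where sin(rx/2) does not vanish, the sum over k is V(1) + ... + V(m) with m the
integer part of 1/|sin(rx/2)|; the indicator form makes the sum a series of functions that
can be integrated termwise. *)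
Definition sine_majorant_term k (x : R) : R := V k.+1 * \1_(near_zero r k.+1) x.

(** The cut-off m is the integer part of 1/s with s = |sin(rx/2)|.  Indices up to
m are handled by |b_k| <= V(k); those beyond m by [sine_tail_le], where
V(m)/s <= 2m V(m) and m V(m) <= V(1) + ... + V(m) by monotonicity of V. *)
Lemma sine_tail_dominated x : sin_half r x != 0 -> exists m, forall n N,
  (n <= N)%N -> cmod (sine_partial b N x - sine_partial b n x)
    <= r.*2.+2%:R * \sum_(0 <= k < m) sine_majorant_term k x.
Proof.
move=> s_neq0; set s := sin_half r x.
have s0 : 0 < s by rewrite lt_neqAle eq_sym s_neq0 normr_ge0.
have s1 : s <= 1 by rewrite /s sin_max.
have sV0 : 0 <= s^-1 by rewrite invr_ge0 ltW.
pose m := Num.truncn s^-1; exists m => n N nN.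
have /andP[ms sm] := Num.Theory.truncn_itv sV0; rewrite -/m in ms sm.
have m0 : (0 < m)%N.
  by rewrite lt0n; apply: contraTneq sm => ->; rewrite -leNgt invf_ge1.
have termE k : (k < m)%N -> sine_majorant_term k x = V k.+1.
  move=> km; rewrite /sine_majorant_term indicE mem_set ?mulr1//.
  rewrite /near_zero/= -/s -ler_pdivlMr// mul1r (le_trans _ ms)// ler_nat.
  exact: km.
set Q := \sum_(0 <= k < m) _.
have QE : Q = \sum_(0 <= k < m) V k.+1.
  by apply: eq_big_nat => k /andP[_]; exact: termE.
have V0 k : 0 <= V k.+1 by exact: rest_variation_ge0 hb _ _.
have mVQ : m%:R * V m <= Q.
  rewrite QE mulr_natl -[X in _ *+ X]card_ord -sumr_const big_mkord.
  by apply: ler_sum => k _; exact: rest_variation_nincr hb _ _ _ _.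
have Q0 : 0 <= Q by rewrite QE sumr_ge0.
have small n' N' : (n' <= N')%N -> (N' <= m)%N ->
    cmod (sine_partial b N' x - sine_partial b n' x) <= Q.
  move=> nN' Nm; rewrite sine_partialB// (le_trans (cmod_sum _ _ _))//.
  apply: (@le_trans _ _ (\sum_(n' <= k < N') V k.+1)).
    rewrite big_add1/=; apply: ler_sum => k _.
    rewrite cmodM cmod_real (le_trans (ler_piMr (cmod_ge0 _) (sin_max _)))//.
    exact: cmod_le_rest_variation hb b0 _ _.
  rewrite QE (big_cat_nat (n := n') (p := m))//=; last exact: leq_trans Nm.
  rewrite [X in _ <= _ + X](big_cat_nat (n := N'))//=.
  rewrite -[X in X <= _]add0r lerD ?sumr_ge0// lerDl sumr_ge0//.
have large n' N' : (n' <= N')%N -> (m <= n')%N ->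
    cmod (sine_partial b N' x - sine_partial b n' x) <= r.*2.+1%:R * Q.
  move=> nN' mn; have := sine_tail_le x nN'; rewrite -/s.
  set c := cmod _ => h.
  have c0 : 0 <= c by exact: cmod_ge0.
  have Vn : V n'.+1 <= V m.
    by apply: (rest_variation_nincr hb) => //; exact: leqW.
  have h1 : 2 * s * c <= r.*2.+1%:R * V m by rewrite (le_trans h)// ler_wpM2l.
  have sm1 : 1 <= s * (2 * m%:R).
    have : 1 <= s * m.+1%:R by rewrite mulrC -ler_pdivrMr// div1r ltW.
    move/le_trans; apply; rewrite ler_wpM2l ?(ltW s0)// -natr1.
    have : 1 <= m%:R :> R by rewrite ler1n.
    lra.
  have : c <= m%:R * (2 * s * c).
    by rewrite -[X in X <= _]mul1r [X in _ <= X](_ : _ = s * (2 * m%:R) * c); [rewrite ler_wpM2r|ring].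
  move/le_trans; apply; apply: (@le_trans _ _ (r.*2.+1%:R * (m%:R * V m))).
    by rewrite [X in _ <= X]mulrCA ler_wpM2l.
  by rewrite ler_wpM2l.
(* The three cases: N <= m, m <= n, and n < m < N, where S_m splits the tail. *)
have [Nm|mN] := leqP N m.
  by rewrite (le_trans (small _ _ nN Nm))// ler_peMl// ler1n.
have [mn|nm] := leqP m n.
  by rewrite (le_trans (large _ _ nN mn))// ler_wpM2r// ler_nat.
rewrite -(subrKA (sine_partial b m x)) (le_trans (cmodD _ _))//.
rewrite -[r.*2.+2%:R]natr1 mulrDl mul1r lerD//; first by apply: large => //; exact: ltnW.
by apply: small => //; exact: ltnW.
Qed.

End SineTails.

(** * The integrable majorant *)

Section SineSeries.
Variables (R : realType) (r : nat) (b : nat -> R[i]) (beta : nat -> R).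
Hypothesis r_gt0 : (0 < r)%N.
Hypothesis hb : RBVS beta r b.
Hypothesis b0 : (b : nat -> R[i]^o) @ \oo --> (0 : R[i]^o).

Local Notation V := (rest_variation r b).
Local Notation mu := (@lebesgue_measure R).
Local Notation D := (`[(- pi)%R, pi%R]%classic : set R).
Local Notation Z := ([set x : R | sin_half r x = 0]).

Lemma sine_partial_cvg x : sin_half r x != 0 ->
  (fun n => sine_partial b n x : R[i]^o) @ \oo --> (sine_sum b x : R[i]^o).
Proof.
move=> s_neq0; set s := sin_half r x.
have s0 : 0 < s by rewrite lt_neqAle eq_sym s_neq0 normr_ge0.
apply: (@cauchy_modulus_cvg _ _ (fun n => r.*2.+1%:R / (2 * s) * V n.+1)).
  rewrite -(mulr0 (r.*2.+1%:R / (2 * s))); apply: cvgM; first exact: cvg_cst.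
  by rewrite (cvg_shiftS V); exact: rest_variation_cvg0 hb.
move=> n N nN; rewrite mulrAC ler_pdivlMr ?mulr_gt0// mulrC.
exact: sine_tail_le r_gt0 hb b0 _ _ _ nN.
Qed.

Lemma measurable_sine_dist n N (E : set R) :
  measurable_fun E (fun x => cmod (sine_partial b n x - sine_partial b N x)).
Proof.
pose P (h : R[i] -> R) n x := \sum_(1 <= k < n.+1) h (b k) * sin (k%:R * x).
have PE m x : sine_partial b m x = P (@complex.Re R) m x +i* P (@complex.Im R) m x.
  rewrite /sine_partial /P; elim/big_rec3 : _ => // k u v w _ ->.
  by case: (b k) => a c; apply/eqP; rewrite eq_complex /= !mulr0 subr0 add0r !eqxx.
have mP h m : measurable_fun setT (P h m).
  apply: measurable_sum => k; apply: continuous_measurable_fun => x.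
  apply: cvgM; first exact: cvg_cst.
  apply: (continuous_comp (g := sin)); last exact: continuous_sin.
  by apply: cvgM; [exact: cvg_cst|exact: cvg_id].
rewrite (_ : (fun x => _) = (fun x => Num.sqrt
   ((P (@complex.Re R) n x - P (@complex.Re R) N x) ^+ 2 +
    (P (@complex.Im R) n x - P (@complex.Im R) N x) ^+ 2))); last first.
  by apply/funext => x; rewrite !PE.
apply: (@measurable_funS _ _ _ _ setT) => //.
apply: (measurableT_comp (continuous_measurable_fun (@sqrt_continuous R))).
by apply: measurable_funD; apply: measurable_funX; apply: measurable_funB.
Qed.

Lemma measurable_sin_half_zeros : measurable Z.
Proof.
by apply: countable_measurable => //; exact: sin_half_zeros_countable.
Qed.

(** Off the zeros of sin(rx/2) the function is a pointwise limit of measurable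
functions; on that countable set every function is measurable. *)
Lemma measurable_sine_remainder n (E : set R) : measurable E ->
  measurable_fun E (fun x => cmod (sine_partial b n x - sine_sum b x)).
Proof.
move=> mE; apply: (@measurable_funS _ _ _ _ setT) => //.
rewrite -(setvU Z); apply/measurable_funU.
- exact: measurableC measurable_sin_half_zeros.
- exact: measurable_sin_half_zeros.
split.
  apply: (measurable_fun_cvg (h := fun N x =>
    cmod (sine_partial b n x - sine_partial b N x))).
    by move=> N; exact: measurable_sine_dist.
  by move=> x /= /eqP xZ; exact/cvg_cmod_dist/sine_partial_cvg.
move=> _ Y _; apply: countable_measurable => //.
apply: sub_countable (sin_half_zeros_countable R r_gt0).
by apply: subset_card_le; exact: subIsetl.
Qed.

Definition sine_majorant (x : R) : \bar R :=
  (r.*2.+2%:R%:E * \sum_(0 <= k <oo) (sine_majorant_term r b k x)%:E)%E.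

Lemma sine_majorant_term_ge0 k x : 0 <= sine_majorant_term r b k x.
Proof. by rewrite mulr_ge0// (rest_variation_ge0 hb). Qed.

Lemma measurable_sine_majorant_term k :
  measurable_fun D (fun x => (sine_majorant_term r b k x)%:E).
Proof.
apply/measurable_EFinP; apply: measurable_funM; first exact: measurable_cst.
by apply: measurable_indic; exact: measurable_near_zero.
Qed.

Lemma integral_sine_majorant_term k :
  (\int[mu]_(x in D) (sine_majorant_term r b k x)%:E
   <= (8 * r.*2.+1%:R)%:E * (V k.+1 / k.+1%:R)%:E)%E.
Proof.
have V0 : 0 <= V k.+1 by exact: rest_variation_ge0 hb _ _.
under eq_integral do rewrite /sine_majorant_term EFinM.
rewrite ge0_integralZl_EFin//; last first.
  by apply/measurable_EFinP/measurable_indic; exact: measurable_near_zero.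
rewrite integral_indic//; last exact: measurable_near_zero.
apply: (@le_trans _ _ ((V k.+1)%:E * (8 * r.*2.+1%:R / k.+1%:R)%:E)%E).
  by rewrite lee_wpmul2l ?lee_fin// lebesgue_measure_near_zero.
by rewrite -!EFinM lee_fin mulrCA mulrA.
Qed.

Hypothesis beta0 : forall n, (0 < n)%N -> 0 <= beta n.
Hypothesis beta_sum : (\sum_(1 <= k <oo) (beta k / k%:R)%:E < +oo)%E.

(** Integrating termwise, the integral is at most a constant times the sum of
the V(k)/k, and V(k) is at most a constant times beta_k. *)
Lemma sine_majorant_integrable : mu.-integrable D sine_majorant.
Proof.
have mD : measurable D by exact: measurable_itv.
have mS : measurable_fun D (fun x =>
    (\sum_(0 <= k <oo) (sine_majorant_term r b k x)%:E)%E).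
  apply: ge0_emeasurable_sum => [k x _ _|k _].
    by rewrite lee_fin sine_majorant_term_ge0.
  exact: measurable_sine_majorant_term.
have S0 x : (0 <= \sum_(0 <= k <oo) (sine_majorant_term r b k x)%:E)%E.
  by apply: nneseries_ge0 => k _ _; rewrite lee_fin sine_majorant_term_ge0.
apply: integrableZl => //; apply/integrableP; split => //.
under eq_integral do rewrite gee0_abs//.
rewrite integral_nneseries//; last 2 first.
- exact: measurable_sine_majorant_term.
- by move=> k x _; rewrite lee_fin sine_majorant_term_ge0.
have [C C0 VC] := rest_variation_le_bound hb beta0.
pose K := 8 * r.*2.+1%:R * C.
apply: (@le_lt_trans _ _ (\sum_(0 <= k <oo) (K%:E * (beta k.+1 / k.+1%:R)%:E))%E).
  apply: lee_nneseries => [k _ _|k _].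
    by apply: integral_ge0 => x _; rewrite lee_fin sine_majorant_term_ge0.
  apply: (le_trans (integral_sine_majorant_term k)).
  rewrite -!EFinM lee_fin /K -[X in _ <= X]mulrA ler_wpM2l// mulrA ler_wpM2r//.
  exact: VC.
rewrite nneseriesZl; last by move=> k _; rewrite lee_fin divr_ge0// beta0.
have K0 : 0 <= K by rewrite mulr_ge0.
(* The term of index 0 of the unshifted series is beta 0 / 0 = 0. *)
have := @nneseries_addn R (fun k => (beta k / k%:R)%:E) 1.
under eq_eseriesr do rewrite addn1.
move=> ->; last first.
  by case=> [|k]; rewrite lee_fin ?invr0 ?mulr0// divr_ge0// beta0.
by rewrite lte_mul_pinfty.
Qed.

(** The limit N -> oo in [sine_tail_dominated]. *)
Lemma sine_remainder_le_majorant n x : sin_half r x != 0 ->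
  ((cmod (sine_partial b n x - sine_sum b x))%:E <= sine_majorant x)%E.
Proof.
move=> xZ; have [m hm] := sine_tail_dominated r_gt0 hb b0 xZ.
apply: (@le_trans _ _ (r.*2.+2%:R *
    \sum_(0 <= k < m) sine_majorant_term r b k x)%:E).
  rewrite lee_fin.
  have := cvg_cmod_dist (a := sine_partial b n x) (sine_partial_cvg xZ).
  move/cvgr_to_le; apply; exists n => // N /= nN.
  by rewrite cmodC; exact: hm.
rewrite EFinM lee_wpmul2l// -sumEFin.
by apply: nneseries_lim_ge => k _ _; rewrite lee_fin sine_majorant_term_ge0.
Qed.

End SineSeries.

(** * Convergence almost everywhere and in mean *)

Theorem theorem5 (R : realType) (r : nat) (beta : nat -> R) (b : nat -> R[i])
  (hr : (2 <= r)%N)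
  (hbeta : forall n : nat, (1 <= n)%N -> 0 <= beta n)
  (hsum : (\sum_(1 <= k <oo) (beta k / k%:R)%:E < +oo)%E)
  (hb : RBVS beta r b)
  (hb0 : (b : nat -> R[i]^o) @ \oo --> (0 : R[i]^o)) :
  {ae @lebesgue_measure R, forall x : R,
     cvg ((fun n => sine_partial b n x : R[i]^o) @ \oo)} /\
  (fun n => L1norm (fun x => sine_partial b n x - sine_sum b x)) @ \oo
    --> (0 : \bar R)%E.
Proof.
have r0 : (0 < r)%N by exact: ltnW.
pose mu := @lebesgue_measure R.
pose Z := [set x : R | sin_half r x = 0].
have mZ : measurable Z by exact: measurable_sin_half_zeros.
have muZ : mu Z = 0%E.
  exact/countable_lebesgue_measure0/sin_half_zeros_countable.
split.
  exists Z; split; [exact: mZ|exact: muZ|move=> x /= div]; apply: contrapT => /eqP xZ; apply: div.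
  by apply/cvg_ex; exists (sine_sum b x); exact: sine_partial_cvg hb hb0 _ xZ.
pose D : set R := `[(- pi)%R, pi%R]%classic.
have mD : measurable D by exact: measurable_itv.
have mDZ : measurable (D `\` Z) by exact: measurableD.
pose f n x := (cmod (sine_partial b n x - sine_sum b x))%:E.
have mf n E : measurable E -> measurable_fun E (f n).
  by move=> mE; apply/measurable_EFinP; exact: measurable_sine_remainder hb hb0 _ _ mE.
have [||||_ _] := @dominated_convergence _ _ R mu _ mDZ f (cst 0%E)
    (sine_majorant r b) (fun n => mf n _ mDZ).
- exact: measurable_cst.
- apply/aeW => x [_ /eqP xZ]; rewrite /f; apply: cvg_EFin.
    exact: nearW.
  have := sine_partial_cvg r0 hb hb0 xZ; move/cvg_cmodP; exact.
- by apply: integrableS (sine_majorant_integrable r0 hb hbeta hsum) => //.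
- apply/aeW => x n [_ /eqP xZ]; rewrite gee0_abs ?lee_fin ?cmod_ge0//.
  exact: sine_remainder_le_majorant hb hb0 _ _ xZ.
rewrite integral0 => intf.
rewrite -[X in _ --> X](mule0 ((2 * pi)^-1)%:E); apply: cvgeZl => //.
apply: cvg_trans intf; apply: near_eq_cvg; apply: nearW => n /=.
(* Domination and pointwise convergence only hold off the null set Z. *)
rewrite (@ge0_negligible_integral _ _ _ mu D Z)//.
  exact: mf.
by move=> x _; rewrite lee_fin cmod_ge0.
Qed.
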